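(* Let $P$ be a finite poset, let $L=\mathcal{J}(P)$ be the lattice of ideals of $P$, and let $K[\mathcal{C}_L]$ be the chain algebra of $L$ over a field $K$. Then the Krull dimension of $K[\mathcal{C}_L]$ is $$\dim K[\mathcal{C}_L]=|L|-|P|.$$
   Context: All posets are finite. An ideal of a poset $P$ is a downward closed subset of $P$ (possibly empty); $\mathcal{J}(P)$ is the set of ideals of $P$ ordered by inclusion, which is a finite distributive lattice. Let $L$ be a finite distributive lattice with elements labelled $t_1,\ldots,t_s$. To a maximal chain $C$ of $L$ associate the monomial $t_C=\prod_{t_i\in C}t_i\in K[t_1,\ldots,t_s]$, $K$ a field. The chain algebra $K[\mathcal{C}_L]$ is the $K$-subalgebra of $K[t_1,\ldots,t_s]$ generated by all $t_C$, $C$ a maximal chain of $L$. *)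

(* Defs.v *)
From HB Require Import structures.
From mathcomp Require Import all_boot all_order all_algebra.
From mathcomp Require Import boolp mpoly.

Set Implicit Arguments.
Unset Strict Implicit.
Unset Printing Implicit Defensive.

Import Order.TTheory GRing.Theory Order.DefaultSetSubsetOrder.
Local Open Scope ring_scope.

(******************************************************************************)
(*        ideals P == the finite distributive lattice J(P) of the ideals      *)
(*                    (downward closed subsets, possibly empty) of the poset  *)
(*                    P, ordered by inclusion                                 *)
(*   max_chain C  <=> C : {set L} is a maximal chain of L                     *)
(*  chain_mon K C  == the product in K[t_x | x in L] of the t_x for x in C    *)
(*      gen_alg G  == the K-subalgebra of A generated by G, as a subtype of A *)
(* chain_algebra K L == the K-subalgebra generated by the chain_mon K C, C  *)
(*                    a maximal chain of L                                    *)
(*    krull_dim R d <-> the Krull dimension of R is d                         *)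
(******************************************************************************)

Fact ideals_display : Order.disp_t. Proof. exact: Order.Disp tt tt. Qed.

Section Ideals.
Context {disp : Order.disp_t} (P : finPOrderType disp).

Definition down_closed : {pred {set P}} :=
  fun I => [forall x in I, forall y, (y <= x)%O ==> (y \in I)].

Lemma down_closedP (I : {set P}) :
  reflect (forall x y : P, x \in I -> (y <= x)%O -> y \in I)
          (I \in down_closed).
Proof.
apply: (iffP forall_inP) => [dI x y xI yx|dI x xI].
  by have /forallP/(_ y)/implyP := dI x xI; apply.
by apply/forallP => y; apply/implyP => /(dI x y xI).
Qed.

Fact down_closedI : Order.ClosedPredicates.meet_closed down_closed.
Proof.
move=> I J /down_closedP dI /down_closedP dJ; apply/down_closedP => x y.
rewrite !in_setI => /andP[xI xJ] yx.
by apply/andP; split; [apply: (dI x)|apply: (dJ x)].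
Qed.

Fact down_closedU : Order.ClosedPredicates.join_closed down_closed.
Proof.
move=> I J /down_closedP dI /down_closedP dJ; apply/down_closedP => x y.
rewrite !in_setU => /orP[xI|xJ] yx; apply/orP.
  by left; apply: (dI x).
by right; apply: (dJ x).
Qed.

Fact down_closed0 : \bot%O \in down_closed.
Proof. by apply/down_closedP => x y; rewrite in_set0. Qed.

Fact down_closedT : \top%O \in down_closed.
Proof. by apply/down_closedP => x y _ _; rewrite in_setT. Qed.

Record ideals : predArgType :=
  Ideal { ideal_set :> {set P}; _ : ideal_set \in down_closed }.

HB.instance Definition _ := [isSub for ideal_set].
HB.instance Definition _ := [Finite of ideals by <:].
HB.instance Definition _ :=
  Order.SubChoice_isTBSubLattice.Build _ _ _ ideals_display ideals
    down_closedI down_closedU down_closed0 down_closedT.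

Fact ideals_meetUl : @left_distributive ideals ideals Order.meet Order.join.
Proof. by move=> I J H; apply: val_inj; apply: setIUl. Qed.

HB.instance Definition _ :=
  Order.Lattice_Meet_isDistrLattice.Build _ ideals ideals_meetUl.

Fact principal_down_closed (x : P) : [set y | (y <= x)%O] \in down_closed.
Proof. by apply/down_closedP => y z; rewrite !inE => yx /le_trans; apply. Qed.

(* The natural-number subtraction #|ideals P| - #|P| is never truncated. *)
Lemma leq_card_ideals : (#|P| <= #|ideals|)%N.
Proof.
apply: (leq_card (fun x => Ideal (principal_down_closed x))) => x y [] /setP E.
by apply: le_anti; move: (E x) (E y); rewrite !inE !lexx => <- ->.
Qed.

End Ideals.

Section GeneratedSubalgebra.
Context {K : fieldType} {A : comAlgType K} (G : seq A).

Definition gen_alg_pred : {pred A} :=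
  fun x => `[< forall S : {pred A},
               subalg_closed S -> {subset G <= S} -> x \in S >].

Fact gen_alg_closed : subalg_closed gen_alg_pred.
Proof.
split=> [|a u v /asboolP uG /asboolP vG|u v /asboolP uG /asboolP vG];
  apply/asboolP => S SS GS; have [S1 Slin SM] := SS.
- exact: S1.
- by apply: Slin; [apply: uG|apply: vG].
- by apply: SM; [apply: uG|apply: vG].
Qed.

HB.instance Definition _ := GRing.isSubalgClosed.Build K A gen_alg_pred
  gen_alg_closed.

Record gen_alg := GenAlg { gen_alg_val :> A; _ : gen_alg_val \in gen_alg_pred }.

HB.instance Definition _ := [isSub for gen_alg_val].
HB.instance Definition _ := [Choice of gen_alg by <:].
HB.instance Definition _ := [SubChoice_isSubComNzRing of gen_alg by <:].
HB.instance Definition _ := [SubZmodule_isSubLmodule of gen_alg by <:].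
HB.instance Definition _ :=
  [SubNzRing_SubLmodule_isSubLalgebra of gen_alg by <:].
HB.instance Definition _ := [SubLalgebra_isSubAlgebra of gen_alg by <:].
End GeneratedSubalgebra.

Section ChainAlgebra.
Context (K : fieldType) {disp : Order.disp_t} (L : finDistrLatticeType disp).

Definition is_chain (C : {set L}) : bool :=
  [forall x in C, forall y in C, (x >=< y)%O].

Definition max_chain : pred {set L} := maxset is_chain.

Definition chain_mon (C : {set L}) : {mpoly K[#|L|]} :=
  \prod_(x in C) 'X_(enum_rank x).

Definition chain_algebra : comAlgType K :=
  gen_alg [seq chain_mon C | C in max_chain].
End ChainAlgebra.

(* Strictly increasing chains p_0 < ... < p_n, hence with n strict inclusions;
   elements of prime_idealr are proper. *)
Definition prime_chain (R : comNzRingType) (n : nat)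
    (p : 'I_n.+1 -> prime_idealr R) : Prop :=
  forall i j : 'I_n.+1, (i < j)%N ->
    {subset p i <= p j} /\ (exists2 x, x \in p j & x \notin p i).

Definition krull_dim (R : comNzRingType) (d : nat) : Prop :=
  (exists p : 'I_d.+1 -> prime_idealr R, prime_chain p) /\
  (forall n (p : 'I_n.+1 -> prime_idealr R), prime_chain p -> (n <= d)%N).

(* Main.v *)
Require Import Defs.
From HB Require Import structures.
From mathcomp Require Import all_boot all_order all_algebra.
From mathcomp Require Import boolp mpoly.

(** Write n for the number of elements of P. Ideals of the same cardinality
    form a level of L = J(P), and a maximal chain of L meets each of the n + 1
    levels exactly once.

    Upper bound. In a monomial lying in the chain algebra, the exponents on
    each level add up to the same number, namely the exponent of the empty
    ideal. After dropping the vertices of a maximal chain other than the empty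
    ideal, one vertex from each of n levels, the remaining |L| - n exponents
    still determine the monomial ([balanced_det]). So the chain algebra has
    O(N^(|L| - n)) monomials of degree O(N). On the other hand, elements
    x_i in p_(i+1) but not in p_i, for a chain of primes
    p_0 < ... < p_r, are algebraically independent ([prime_chain_free]), and
    the N^r products of powers x_i^a with a < N have degree O(N). Comparing
    the two rates of growth gives r <= |L| - n ([prime_chain_length_le]).

    Lower bound. For a set T of vertices, killing the variables outside T is
    an endomorphism of the polynomial ring, so that its kernel on the chain
    algebra is prime; the kernel shrinks when T grows, and strictly so as soon
    as a maximal chain lies in the larger set but not in the smaller one.
    Shellability of L provides enough sets T: the vertices can be listed
    so that the first n + 1 of them form a maximal chain and every later
    vertex lies on a maximal chain all of whose other vertices come earlier
    ([max_chain_filtration]). Concretely, fix a linear extension of P and list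
    the ideals by their number of inversions, that is, of pairs of an element
    outside the ideal that precedes an element inside. The maximal chain
    through I that adds the elements in the order of the linear extension,
    first inside I and then outside ([sweep]), has fewer inversions
    everywhere else, unless I has none itself ([sweep_inversions]). *)

Set Implicit Arguments.
Unset Strict Implicit.
Unset Printing Implicit Defensive.

Import Order.TTheory GRing.Theory Order.DefaultSetSubsetOrder.
Local Open Scope ring_scope.

(** * Algebraic independence along a chain of primes *)

Lemma idealr_scale (K : fieldType) (R : comAlgType K) (I : idealr R) c x :
  x \in I -> c *: x \in I.
Proof. by move=> xI; rewrite -mulr_algl idealMr. Qed.

Lemma prime_idealrX (R : comNzRingType) (I : prime_idealr R) x k :
  x \notin I -> x ^+ k \notin I.
Proof.
move=> xI; elim: k => [|k IHk]; first by rewrite expr0 idealr1.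
by rewrite exprS prime_idealrM negb_or xI.
Qed.

(** At stage i, keep the exponents that are minimal in coordinate i. Their
    common power of x i can be cancelled modulo p i since x i is not in p i, and
    the terms with a larger exponent vanish modulo p i.+1 since x i lies in it.
    In the end a single nonzero scalar lies in the proper ideal p n. *)
Lemma prime_chain_free (K : fieldType) (R : comAlgType K) (n N : nat)
    (p : nat -> prime_idealr R) (x : nat -> R) (c : {ffun 'I_n -> 'I_N} -> K) :
  (forall i, (i < n)%N ->
     [/\ {subset p i <= p i.+1}, x i \in p i.+1 & x i \notin p i]) ->
  \sum_a c a *: \prod_(j < n) x j ^+ a j = 0 -> forall a, c a = 0.
Proof.
move=> px c0 a1; apply/eqP/negPn/negP => ca1.
have: forall i, (i <= n)%N -> exists S : {set {ffun 'I_n -> 'I_N}},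
    [/\ exists a, a \in S, forall a, a \in S -> c a != 0,
        forall (a b : {ffun 'I_n -> 'I_N}) (j : 'I_n),
          a \in S -> b \in S -> (j < i)%N -> a j = b j
      & \sum_(a in S) c a *: \prod_(j < n | (i <= j)%N) x j ^+ a j \in p i].
  elim=> [_|i IHi lt_in].
    exists [set a | c a != 0]; split => //; first by exists a1; rewrite inE.
      by move=> a; rewrite inE.
    rewrite big_mkcond /= [X in X \in _](_ : _ = 0) ?idealr0 //.
    rewrite -[RHS]c0; apply: eq_bigr => a _; rewrite inE.
    by case: eqP => [->|//]; rewrite scale0r.
  have [S [[a0 a0S] Sc Sagree SI]] := IHi (ltnW lt_in).
  have [sub_p xi_in xi_notin] := px i lt_in.
  pose I := Ordinal lt_in.
  case: (arg_minnP (fun a : {ffun 'I_n -> 'I_N} => a I : nat) a0S) => am.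
  rewrite -/(am \in S) => amS am_min.
  set m := (am I : nat) in am_min.
  pose F := \sum_(a in S)
    c a *: (x i ^+ (a I - m) * \prod_(j < n | (i.+1 <= j)%N) x j ^+ a j).
  have EF : \sum_(a in S) c a *: \prod_(j < n | (i <= j)%N) x j ^+ a j
            = x i ^+ m * F.
    rewrite mulr_sumr; apply: eq_bigr => a aS.
    rewrite -scalerAr mulrA -exprD subnKC ?am_min // (bigD1 I) //=.
    congr (_ *: (_ * _)); apply: eq_bigl => j.
    by rewrite ltn_neqAle eq_sym andbC -(inj_eq val_inj).
  move: SI; rewrite EF prime_idealrM (negPf (prime_idealrX _ xi_notin)) /=.
  move/sub_p; rewrite /F.
  rewrite (bigID (fun a : {ffun 'I_n -> 'I_N} => a I == m :> nat)) /=.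
  rewrite rpredDr; last first.
    apply: rpred_sum => a /andP[aS am_neq]; apply: idealr_scale.
    rewrite mulrC idealMr // -(subnSK (n := a I) (m := m)).
      by rewrite exprS mulrC idealMr.
    by rewrite ltn_neqAle eq_sym am_neq am_min.
  move=> FI; exists [set a in S | a I == m :> nat]; split.
  - by exists am; rewrite inE eqxx andbT.
  - by move=> a; rewrite inE => /andP[/Sc].
  - move=> a b j; rewrite !inE => /andP[aS /eqP am'] /andP[bS /eqP bm].
    rewrite ltnS leq_eqVlt => /orP[/eqP ji|]; last exact: Sagree.
    have -> : j = I by apply/val_inj.
    by apply/val_inj; rewrite /= am' bm.
  - rewrite (eq_bigl (fun a => (a \in S) && (a I == m :> nat))); last first.
      by move=> a; rewrite inE.
    have <- // : \sum_(a in S | a I == m :> nat) c a *: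
        (x i ^+ (a I - m) * \prod_(j < n | (i < j)%N) x j ^+ a j)
      = \sum_(a in S | a I == m :> nat)
          c a *: \prod_(j < n | (i < j)%N) x j ^+ a j.
    by apply: eq_bigr => a /andP[_ /eqP->]; rewrite subnn mul1r.
case/(_ n (leqnn n)) => S [[a aS] Sc Sagree].
have -> : S = [set a].
  apply/setP => b; rewrite inE; apply/idP/eqP => [bS|-> //].
  by apply/ffunP => j; apply: Sagree.
rewrite big_set1.
rewrite big1 => [|j]; last by rewrite leqNgt ltn_ord.
move/(idealr_scale (c a)^-1); rewrite scalerA mulVf ?Sc // scale1r.
by rewrite idealr1.
Qed.

(** The coefficient matrix has more rows than columns. *)
Lemma mpoly_linear_dependence (K : fieldType) (s : nat) (A : finType)
    (E : seq 'X_{1..s}) (f : A -> {mpoly K[s]}) :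
  (forall a, {subset msupp (f a) <= E}) -> (size E < #|A|)%N ->
  exists2 c : A -> K, exists a, c a != 0 & \sum_a c a *: f a = 0.
Proof.
move=> fE ltEA.
pose M := \matrix_(i < #|A|, j < size E) (f (enum_val i))@_(nth 0%MM E j).
have [u /sub_kermxP uM u_neq0] :
    exists2 u : 'rV_#|A|, (u <= kermx M)%MS & u != 0.
  apply/rowV0Pn; rewrite -mxrank_eq0 mxrank_ker -lt0n subn_gt0.
  exact: leq_ltn_trans (rank_leq_col M) ltEA.
exists (fun a => u ord0 (enum_rank a)).
  have [j uj] : exists j, u ord0 j != 0.
    apply/existsP; apply: contraNT u_neq0 => /existsPn u0.
    by apply/eqP/rowP => j; rewrite mxE; apply/eqP/negPn/u0.
  by exists (enum_val j); rewrite enum_valK.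
apply/mpolyP => m; rewrite mcoeff0 raddf_sum /=.
have [mE|mE] := boolP (m \in E); last first.
  rewrite big1 // => a _; rewrite mcoeffZ (memN_msupp_eq0 (p := f a)) ?mulr0 //.
  by apply: contra mE => /fE.
have /rowP/(_ (Ordinal (etrans (index_mem m E) mE))) := uM.
rewrite !mxE /= => uM0; rewrite -[RHS]uM0.
rewrite (reindex_onto (@enum_rank A) enum_val) => [|i _]; last exact: enum_valK.
apply: eq_big => [a|a _]; first by rewrite enum_rankK eqxx.
by rewrite mcoeffZ mxE enum_rankK nth_index.
Qed.

(** * Growth bounds the length of chains of primes *)

Lemma mdeg_msupp_prodX (K : fieldType) (s n : nat) (f : 'I_n -> {mpoly K[s]})
    (a : 'I_n -> nat) m :
  m \in msupp (\prod_j f j ^+ a j) -> (mdeg m <= \sum_j a j * msize (f j))%N.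
Proof.
pose deg_le (g : {mpoly K[s]}) k := forall m, m \in msupp g -> (mdeg m <= k)%N.
have deg_le1 : deg_le 1 0%N.
  by move=> m'; rewrite msupp1 inE => /eqP->; rewrite mdeg0.
have deg_leM g h k l : deg_le g k -> deg_le h l -> deg_le (g * h) (k + l)%N.
  move=> gk hl m' /msuppM_le /allpairsP[[m1 m2] /= [m1g m2h ->]].
  by rewrite mdegD leq_add ?gk ?hl.
suff : deg_le (\prod_j f j ^+ a j) (\sum_j a j * msize (f j))%N by apply.
apply: (big_rec2 deg_le) => // j g k _; apply/deg_leM.
elim: (a j) => [|b IHb]; first by rewrite expr0 mul0n.
by rewrite exprS mulSn; apply/deg_leM => // m' /msize_mdeg_lt /ltnW.
Qed.

(** Each of the exponents in W, which determine the monomial, is bounded by its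
    degree. *)
Lemma card_bounded_mnm (s B : nat) (M : pred 'X_{1..s}) (W : {set 'I_s}) :
  (forall m m', M m -> M m' -> {in W, m =1 m'} -> m = m') ->
  (#|[pred m : 'X_{1..s < B.+1} | M (bmnm m)]| <= B.+1 ^ #|W|)%N.
Proof.
move=> Mdet.
pose rho (m : 'X_{1..s < B.+1}) : {ffun {i | i \in W} -> 'I_B.+1} :=
  [ffun i => inord (m (val i))].
have -> : (B.+1 ^ #|W| = #|{ffun {i | i \in W} -> 'I_B.+1}|)%N.
  by rewrite card_ffun card_ord card_sig.
have mB (m : 'X_{1..s < B.+1}) i : (m i < B.+1)%N.
  by apply: leq_ltn_trans (bmdeg m); rewrite mdegE (bigD1 i) //= leq_addr.
apply: (@leq_card_in _ _ rho) => m m' Mm Mm' /ffunP rho_eq.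
apply: val_inj; apply: Mdet => // i iW; have := rho_eq (exist _ i iW).
by rewrite !ffunE => /(congr1 val) /=; rewrite !inordK.
Qed.

(** If n > |W|, the N ^ n products of powers below N of n suitable elements
    would be linearly independent, although they involve at most
    (N * C + 1) ^ |W| <= (C + 1) ^ |W| * N ^ |W| monomials, where C bounds the
    sum of the degrees of the elements; this fails for N > (C + 1) ^ |W|. *)
Lemma prime_chain_length_le (K : fieldType) (s : nat) (R : comAlgType K)
    (v : {rmorphism R -> {mpoly K[s]}}) (M : pred 'X_{1..s}) (W : {set 'I_s}) :
  scalable v -> injective v -> (forall r m, m \in msupp (v r) -> M m) ->
  (forall m m', M m -> M m' -> {in W, m =1 m'} -> m = m') ->
  forall n (p : 'I_n.+1 -> prime_idealr R), prime_chain p -> (n <= #|W|)%N.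
Proof.
move=> vZ v_inj vM Mdet n p pp; rewrite leqNgt; apply/negP => ltWn.
pose q i := p (inord i).
have /choice[x qx] : forall i, exists x : R, (i < n)%N ->
    [/\ {subset q i <= q i.+1}, x \in q i.+1 & x \notin q i].
  move=> i; case: (boolP (i < n)%N) => [lt_in|_]; last by exists 0.
  have := pp (inord i) (inord i.+1).
  rewrite !inordK ?ltnS //; last exact: ltnW.
  by case=> // sub_p [y y1 y0]; exists y.
pose w := #|W|; pose C := (\sum_(j < n) msize (v (x j)))%N.
pose N := (C.+1 ^ w).+1.
pose f (a : {ffun 'I_n -> 'I_N}) := \prod_(j < n) x j ^+ a j.
pose E := [seq bmnm m | m in [pred m : 'X_{1..s < (N * C).+1} | M (bmnm m)]].
have fE a : {subset msupp (v (f a)) <= E}.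
  move=> m mf.
  have degm : (mdeg m < (N * C).+1)%N.
    have: m \in msupp (\prod_(j < n) v (x j) ^+ a j).
      move: mf; rewrite /f rmorph_prod /=.
      by under eq_bigr => j _ do rewrite rmorphXn /=.
    move/mdeg_msupp_prodX/leq_trans; apply; rewrite /C big_distrr /=.
    by apply: leq_sum => j _; rewrite leq_mul2r ltnW ?orbT.
  apply/imageP; exists (BMultinom degm) => //=; exact: vM mf.
have sizeE : (size E < #|{: {ffun 'I_n -> 'I_N}}|)%N.
  rewrite size_image card_ffun !card_ord.
  apply: leq_ltn_trans (card_bounded_mnm _ Mdet) _; rewrite -/w.
  have leN : ((N * C).+1 <= N * C.+1)%N by rewrite mulnS addnC -addn1 leq_add2l.
  apply: (@leq_trans (N ^ w.+1)%N); last by rewrite leq_pexp2l.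
  apply: (@leq_ltn_trans ((N * C.+1) ^ w)%N).
    by case: (posnP w) => [->|w0]; rewrite ?expn0 ?leq_exp2r.
  by rewrite expnMn expnSr ltn_pmul2l ?expn_gt0.
have [c [a ca] c0] := mpoly_linear_dependence fE sizeE.
suff c_eq0 : forall a, c a = 0 by rewrite c_eq0 eqxx in ca.
apply: (prime_chain_free qx); apply: v_inj.
rewrite raddf0 raddf_sum -[RHS]c0; apply: eq_bigr => b _.
exact: vZ.
Qed.

(** * Monomials and prime ideals of generated subalgebras *)

Lemma gen_alg_msupp (K : fieldType) (s : nat) (G : seq {mpoly K[s]})
    (M : pred 'X_{1..s}) :
  M 0%MM -> (forall m m', M m -> M m' -> M (m + m')%MM) ->
  (forall g m, g \in G -> m \in msupp g -> M m) ->
  forall (r : gen_alg G) m, m \in msupp (val r) -> M m.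
Proof.
move=> M0 MD GM r; suff /allP : all M (msupp (val r)) by [].
have /asboolP/(_ [pred f | all M (msupp f)]) := valP r; apply.
  split=> [|c f g /= /allP fM /allP gM|f g /= /allP fM /allP gM].
  - by rewrite inE /= msupp1 /= M0.
  - apply/allP => m /msuppD_le; rewrite mem_cat.
    by case/orP=> [/msuppZ_le/fM|/gM].
  - apply/allP => m /msuppM_le /allpairsP[[m1 m2] /= [/fM m1M /gM m2M ->]].
    exact: MD.
by move=> g gG; apply/allP => m; apply: GM.
Qed.

Section Kernel.
Context (R : comNzRingType) (D : idomainType) (f : {rmorphism R -> D}).

Definition kernel : {pred R} := fun x => f x == 0.

Fact kernel_idealr_closed : idealr_closed kernel.
Proof.
split=> [||a u v]; rewrite !unfold_in /kernel ?rmorph0 ?rmorph1 ?oner_eq0 //.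
by rewrite rmorphD rmorphM => /eqP-> /eqP->; rewrite mulr0 addr0.
Qed.

Fact kernel_prime_closed : prime_idealr_closed kernel.
Proof. by move=> u v; rewrite !unfold_in /kernel rmorphM mulf_eq0. Qed.

HB.instance Definition _ := isIdealr.Build R kernel kernel_idealr_closed.
HB.instance Definition _ :=
  isPrimeIdealrClosed.Build R kernel kernel_prime_closed.

End Kernel.

(** * Maximal chains of ideals *)

Lemma nat_ivt (g : nat -> nat) N v :
  (forall k, g k.+1 <= (g k).+1)%N -> (g 0 <= v <= g N)%N ->
  exists2 k, (k <= N)%N & g k = v.
Proof.
move=> g_step /andP[g0v]; elim: N => [|N IHN] vgN.
  by exists 0%N => //; apply/eqP; rewrite eqn_leq g0v.
have [/IHN[k kN <-]|ltgN] := leqP v (g N); first by exists k => //; apply: leqW.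
exists N.+1 => //; apply/eqP; rewrite eqn_leq vgN andbT.
exact: leq_trans (g_step N) ltgN.
Qed.

Section Ideals.
Context {disp : Order.disp_t} (P : finPOrderType disp).
Local Notation L := (ideals P).
Implicit Types (I J U : L) (C : {set L}).

Lemma comparable_idealE I J : (I >=< J)%O = (I \subset J) || (J \subset I).
Proof. by []. Qed.

Lemma card_comparable_inj I J : (I >=< J)%O -> #|I| = #|J| -> I = J.
Proof.
rewrite comparable_idealE => IJ cardIJ; apply: val_inj; apply/eqP.
by case/orP: IJ => sIJ; [|rewrite eq_sym]; rewrite eqEcard sIJ cardIJ leqnn.
Qed.

Lemma chainP C :
  reflect {in C &, forall I J, (I >=< J)%O} (is_chain C).
Proof.
apply: (iffP forall_inP) => [C_ch I J IC JC|C_ch I IC].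
  exact: (forall_inP (C_ch I IC)).
by apply/forall_inP => J JC; apply: C_ch.
Qed.

Lemma max_chain_mem C I :
  max_chain C -> {in C, forall J, (I >=< J)%O} -> I \in C.
Proof.
move=> /maxsetP[/chainP C_ch C_max] IC.
suff <- : I |: C = C by rewrite setU11.
apply: C_max; last exact: subsetUr.
apply/chainP => J U /setU1P[->|JC] /setU1P[->|UC].
- exact: comparablexx.
- exact: IC.
- by rewrite comparable_sym IC.
- exact: C_ch.
Qed.

Lemma bot_max_chain C : max_chain C -> \bot%O \in C.
Proof.
by move/max_chain_mem; apply=> J _; rewrite /Order.comparable le0x.
Qed.

(** Add to I an element of J that is minimal outside I. *)
Lemma exists_cover I J : I \subset J -> (#|I| < #|J|)%N ->
  exists2 U : L, #|U| = #|I|.+1 & (I \subset U) && (U \subset J).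
Proof.
move=> sIJ ltIJ.
have /card_gt0P[x0 x0D] : (0 < #|J :\: I|)%N.
  by rewrite cardsD (setIidPr sIJ) subn_gt0.
have [x xD x_min] := arg_minnP (fun x => #|[set y : P | (y <= x)%O]|) x0D.
have /setDP[xJ xI] : x \in J :\: I := xD.
have U_down : x |: I \in @down_closed _ P.
  apply/down_closedP => y z /setU1P[->|yI] zy.
    have [->|z_neq] := eqVneq z x; first by rewrite setU11.
    rewrite in_setU1; apply/orP; right; apply: contraT => zI.
    have zJ : z \in J by apply: (down_closedP _ (valP J)) xJ zy.
    have /x_min : z \in J :\: I by rewrite inE zI.
    rewrite leqNgt proper_card //; apply/properP; split.
      by apply/subsetP => t; rewrite !inE => /le_trans; apply.
    by exists x; rewrite !inE ?lexx // lt_geF // lt_neqAle z_neq.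
  by rewrite in_setU1 (down_closedP _ (valP I) _ _ yI zy) orbT.
exists (Ideal U_down) => /=; first by rewrite cardsU1 xI.
by rewrite subsetUr subUset sub1set xJ sIJ.
Qed.

(** Let J be the smallest member of C with more elements than the member I.
    An ideal with one more element than I that lies between I and J is
    comparable with all of C, hence belongs to C by maximality. *)
Lemma max_chain_level C k : max_chain C -> (k <= #|P|)%N ->
  exists2 I, I \in C & #|I| = k.
Proof.
move=> C_max; elim: k => [_|k IHk ltkP].
  by exists \bot%O; [apply: bot_max_chain|apply: cards0].
have [I IC cardI] := IHk (ltnW ltkP).
have /chainP C_ch := maxsetp C_max.
have topC : \top%O \in C.
  by apply: max_chain_mem => // J _; rewrite /Order.comparable lex1 orbT.
have topP : (\top%O \in C) && (#|I| < #|(\top%O : L)|)%N.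
  by rewrite topC cardI cardsT.
have [J /andP[JC ltIJ] J_min] :=
  arg_minnP (P := fun J => (J \in C) && (#|I| < #|J|)%N) (fun J => #|J|) topP.
have le_card_sub U V : U \in C -> V \in C -> (#|U| <= #|V|)%N -> U \subset V.
  move=> UC VC leUV; have := C_ch _ _ UC VC; rewrite comparable_idealE.
  case/orP=> // sVU; move: leUV.
  by rewrite -(geq_leqif (subset_leqif_card sVU)).
have sIJ := le_card_sub _ _ IC JC (ltnW ltIJ).
have [U cardU /andP[sIU sUJ]] := exists_cover sIJ ltIJ.
exists U; last by rewrite cardU cardI.
apply: max_chain_mem => // V VC; rewrite comparable_idealE.
have [leVI|ltIV] := leqP #|V| #|I|.
  by rewrite (subset_trans (le_card_sub _ _ VC IC leVI) sIU) orbT.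
by rewrite (subset_trans sUJ) // le_card_sub // J_min // VC.
Qed.

Lemma level_max_chain C : is_chain C ->
  (forall k, (k <= #|P|)%N -> exists2 I, I \in C & #|I| = k) -> max_chain C.
Proof.
move=> C_ch C_lev; apply/maxsetP; split=> // D /chainP D_ch sCD.
apply/eqP; rewrite eqEsubset sCD andbT; apply/subsetP => J JD.
have [I IC cardI] := C_lev #|J| (max_card _).
by rewrite -(card_comparable_inj (D_ch _ _ (subsetP sCD _ IC) JD) cardI).
Qed.

Lemma leq_card_chain C : is_chain C -> (#|C| <= #|P|.+1)%N.
Proof.
move=> /chainP C_ch; rewrite -[X in (_ <= X)%N]card_ord.
apply: (@leq_card_in _ _ (fun I => inord #|I|)) => I J IC JC.
move/(congr1 val); rewrite /= !inordK ?ltnS ?max_card //.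
exact: card_comparable_inj (C_ch _ _ IC JC).
Qed.

Lemma card_max_chain C : max_chain C -> #|C| = #|P|.+1.
Proof.
move=> C_max; apply/eqP; rewrite eqn_leq leq_card_chain ?(maxsetp C_max) //=.
rewrite -[X in (X <= _)%N]card_ord -cardsT.
apply: leq_trans (leq_imset_card (fun I => inord #|I| : 'I_#|P|.+1) C).
apply/subset_leq_card/subsetP => k _.
have [I IC cardI] := max_chain_level C_max (ltn_ord k : (k <= #|P|)%N).
by apply/imsetP; exists I; rewrite // cardI inord_val.
Qed.

(** * Shelling the lattice of ideals *)

(** A linear extension of P: the size of the principal ideal is strictly
    increasing, and the second summand breaks ties. *)
Definition label (x : P) : nat :=
  (#|[set y | (y <= x)%O]| * #|P| + enum_rank x)%N.

Lemma label_inj : injective label.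
Proof.
move=> x y /(congr1 (modn^~ #|P|)); rewrite /label !modnMDl !modn_small //.
by move/val_inj/enum_rank_inj.
Qed.

Lemma le_label x y : (x <= y)%O -> (label x <= label y)%N.
Proof.
rewrite le_eqVlt => /orP[/eqP-> //|ltxy]; rewrite ltnW // /label.
have lt_down : (#|[set z | (z <= x)%O]| < #|[set z | (z <= y)%O]|)%N.
  apply/proper_card/properP; split.
    by apply/subsetP => z; rewrite !inE => /le_trans; apply; apply: ltW.
  by exists y; rewrite !inE ?lexx // lt_geF.
apply: (@leq_trans (#|[set z | (z <= x)%O]|.+1 * #|P|)).
  by rewrite mulSn addnC ltn_add2r.
by apply: leq_trans (leq_addr _ _); rewrite leq_mul2r lt_down orbT.
Qed.

Fact prefix_down_closed k : [set x : P | (label x < k)%N] \in @down_closed _ P.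
Proof.
by apply/down_closedP => x y; rewrite !inE => ltxk /le_label/leq_ltn_trans->.
Qed.

Definition prefix k : L := Ideal (prefix_down_closed k).

Definition label_bound : nat := (\max_x label x).+1.

Lemma mem_prefix_bound x : x \in prefix label_bound.
Proof. by rewrite inE ltnS (leq_bigmax (F := label)). Qed.

Lemma subset_prefix k l : (k <= l)%N -> prefix k \subset prefix l.
Proof.
by move=> kl; apply/subsetP => x; rewrite !inE => /leq_trans; apply.
Qed.

Lemma prefixS k : exists D : {set P},
  (#|D| <= 1)%N /\ (prefix k.+1 : {set P}) = prefix k :|: D.
Proof.
exists [set x | label x == k]; split; last first.
  by apply/setP => x; rewrite !inE ltnS leq_eqVlt orbC.
apply/card_le1_eqP => x y; rewrite !inE => /eqP lx /eqP ly.
by apply: label_inj; rewrite lx ly.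
Qed.

(** The maximal chain through I that reaches I by adding its elements by
    increasing label, and then adds the missing elements by increasing label. *)
Definition sweep I : {set L} :=
  [set (I `&` prefix k)%O | k : 'I_label_bound.+1]
  :|: [set (I `|` prefix k)%O | k : 'I_label_bound.+1].

Lemma sweepP I U : reflect
  (exists2 k, (k <= label_bound)%N
     & U = (I `&` prefix k)%O \/ U = (I `|` prefix k)%O)
  (U \in sweep I).
Proof.
apply: (iffP setUP) => [[] /imsetP[k _ ->]|[k lek [->|->]]].
- by exists k; [rewrite -ltnS|left].
- by exists k; [rewrite -ltnS|right].
- by left; apply/imsetP; exists (Ordinal (lek : k < label_bound.+1)%N).
- by right; apply/imsetP; exists (Ordinal (lek : k < label_bound.+1)%N).
Qed.

Lemma sweep_self I : I \in sweep I.
Proof.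
apply/sweepP; exists label_bound => //; left; apply: val_inj.
by apply/esym/setIidPl/subsetP => x _; apply: mem_prefix_bound.
Qed.

Lemma sweep_chain I : is_chain (sweep I).
Proof.
have meetP k l : (k <= l)%N -> (I `&` prefix k <= I `&` prefix l)%O.
  by move=> kl; apply: leI2 => //; apply: subset_prefix.
have joinP k l : (k <= l)%N -> (I `|` prefix k <= I `|` prefix l)%O.
  by move=> kl; apply: leU2 => //; apply: subset_prefix.
have mjP k l : (I `&` prefix k <= I `|` prefix l)%O.
  exact: le_trans (leIl _ _) (leUl _ _).
apply/chainP => _ _ /sweepP[k _ [->|->]] /sweepP[l _ [->|->]].
all: rewrite /Order.comparable ?mjP ?orbT //.
- by case/orP: (leq_total k l) => /meetP ->; rewrite ?orbT.
- by case/orP: (leq_total k l) => /joinP ->; rewrite ?orbT.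
Qed.

(** Each of the two halves is a sequence whose cardinalities increase by at most
    one, so that together they meet all levels. *)
Lemma sweep_max_chain I : max_chain (sweep I).
Proof.
apply: level_max_chain (sweep_chain I) _ => v vP.
have [vI|/ltnW Iv] := leqP v #|I|.
  have [||k kN <-] := @nat_ivt (fun k => #|I :&: prefix k|) label_bound v.
  - move=> k; have [D [D1 ->]] := prefixS k.
    rewrite setIUr (leq_trans (leq_card_setU _ _)) // -addn1 leq_add2l.
    by rewrite (leq_trans _ D1) // subset_leq_card ?subsetIr.
  - apply/andP; split; last first.
      apply: (leq_trans vI); apply/subset_leq_card/subsetP => x xI.
      by rewrite in_setI xI mem_prefix_bound.
    rewrite (_ : _ :&: _ = set0) ?cards0 //.
    by apply/setP => x; rewrite !inE ltn0 andbF.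
  by exists (I `&` prefix k)%O => //; apply/sweepP; exists k => //; left.
have [||k kN <-] := @nat_ivt (fun k => #|I :|: prefix k|) label_bound v.
- move=> k; have [D [D1 ->]] := prefixS k.
  by rewrite setUA (leq_trans (leq_card_setU _ _)) // -addn1 leq_add2l.
- apply/andP; split; first rewrite (_ : _ :|: _ = I) //.
    by apply/setP => x; rewrite !inE ltn0 orbF.
  apply: (leq_trans vP); rewrite -cardsT; apply/subset_leq_card/subsetP => x _.
  by rewrite in_setU mem_prefix_bound orbT.
by exists (I `|` prefix k)%O => //; apply/sweepP; exists k => //; right.
Qed.

Definition inversions (I : L) : {set P * P} :=
  [set z | [&& (label z.1 < label z.2)%N, z.1 \notin I & z.2 \in I]].

(** Meeting or joining with an initial segment of the labelling creates no
    inversion. If it removes an element x of I, then x and an inversion (i, j)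
    of I yield an inversion (i, x) or (i, j) whose second member is removed;
    adding a missing element x destroys (x, j) or (i, j) in the same way. *)
Lemma sweep_inversions I U : U \in sweep I ->
  inversions U = set0 \/ U = I \/ (#|inversions U| < #|inversions I|)%N.
Proof.
case/sweepP => k _ UE.
have sUI : inversions U \subset inversions I.
  apply/subsetP => -[i j]; rewrite !inE /= => /and3P[ltij iU jU].
  rewrite ltij /=; move: iU jU; case: UE => -> /=; rewrite !inE.
    rewrite negb_and => /orP[-> /andP[-> //]|lei /andP[-> ltj]].
    by move: lei; rewrite (ltn_trans ltij ltj).
  rewrite negb_or => /andP[-> /=] /negP lei /orP[//|ltj].
  by case: lei; apply: ltn_trans ltij ltj.
have [I0|[[i j]]] := set_0Vmem (inversions I).
  by left; apply/eqP; rewrite -subset0 -I0.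
rewrite inE /= => /and3P[ltij iI jI]; right.
have [->|neqUI] := eqVneq U I; [by left|right].
suff [z zI zU] : exists2 z, z \in inversions I & z \notin inversions U.
  by apply/proper_card/properP; split=> //; exists z.
case: UE => UE.
  have /subsetPn[x xI xk] : ~~ (I \subset prefix k).
    by apply: contra_neqN neqUI => /setIidPl Ik; apply: val_inj; rewrite UE.
  rewrite inE -leqNgt in xk.
  exists (i, if (label j <= label x)%N then x else j).
    by rewrite inE /= iI; case: (leqP (label j)) => [le_jx|_];
      rewrite ?(leq_trans ltij le_jx) ?ltij ?xI ?jI.
  rewrite UE !inE /= !negb_and; apply/orP; right; apply/orP; right.
  apply/orP; right; rewrite -leqNgt; case: (leqP (label j)) => // /ltnW.
  exact: leq_trans.
have /subsetPn[x] : ~~ (prefix k \subset I).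
  by apply: contra_neqN neqUI => /setUidPl Ik; apply: val_inj; rewrite UE.
rewrite inE => xk xI.
exists (if (label x <= label i)%N then x else i, j).
  rewrite inE /= jI; case: (leqP (label x) (label i)) => [le_xi|_];
    rewrite ?xI ?iI ?ltij //=.
  by rewrite (leq_ltn_trans le_xi ltij).
rewrite UE !inE /= !negb_and negbK; apply/orP; right; apply/orP; left.
by apply/orP; right; case: (leqP (label x) (label i)) => // /ltn_trans; apply.
Qed.

(** An ideal without inversions is an initial segment of the labelling. *)
Lemma no_inversion_chain : is_chain [set I : L | inversions I == set0].
Proof.
apply/chainP => I J; rewrite !inE => /eqP I0 /eqP J0.
rewrite comparable_idealE; apply: contraT.
rewrite negb_or => /andP[/subsetPn[x xI xJ] /subsetPn[y yJ yI]].
have [ltxy|ltyx|/label_inj xy] := ltngtP (label x) (label y).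
- by have := in_set0 (x, y); rewrite -J0 inE /= ltxy xJ yJ.
- by have := in_set0 (y, x); rewrite -I0 inE /= ltyx xI yI.
- by rewrite xy yJ in xJ.
Qed.

Definition inversion_order : seq L :=
  sort (fun I J => #|inversions I| <= #|inversions J|)%N (enum L).

Definition position I : nat := index I inversion_order.

Lemma mem_inversion_order I : I \in inversion_order.
Proof. by rewrite mem_sort mem_enum. Qed.

Lemma uniq_inversion_order : uniq inversion_order.
Proof. by rewrite sort_uniq enum_uniq. Qed.

Lemma le_position I J : (position I <= position J)%N ->
  (#|inversions I| <= #|inversions J|)%N.
Proof.
have le_tr : transitive (fun I J => #|inversions I| <= #|inversions J|)%N.
  by move=> ? ? ?; apply: leq_trans.
have le_tot : total (fun I J => #|inversions I| <= #|inversions J|)%N.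
  by move=> ? ?; apply: leq_total.
have := sorted_leq_index le_tr (fun _ => leqnn _) (sort_sorted le_tot (enum L)).
by apply; rewrite ?mem_inversion_order.
Qed.

Lemma lt_position I J : (#|inversions I| < #|inversions J|)%N ->
  (position I < position J)%N.
Proof. by rewrite !ltnNge; apply: contra; apply: le_position. Qed.

(** Ideals without inversions come first, and as a chain they are at most
    #|P| + 1 in number. *)
Lemma position_no_inversion I : inversions I = set0 -> (position I <= #|P|)%N.
Proof.
move=> I0; rewrite -ltnS.
apply: leq_trans (leq_card_chain no_inversion_chain).
have ltI : (position I < size inversion_order)%N.
  by rewrite index_mem mem_inversion_order.
rewrite -(size_takel ltI) -(card_uniqP (take_uniq _ uniq_inversion_order)).
apply/subset_leq_card/subsetP => J JI; rewrite inE -cards_eq0 -leqn0.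
rewrite -[X in (_ <= X)%N](cards0 (P * P)%type) -I0 le_position //.
by move: JI; rewrite in_take_leq // => /(_ ltI); rewrite ltnS.
Qed.

(** Apart from T 0 = set0, take for T i the first #|P| + i ideals in the order
    of inversions. The chain of inversion-free ideals already fits in T 1, and
    passing from T i to T i.+1 appends one ideal I, hence completes sweep I. *)
Lemma max_chain_filtration : exists T : nat -> {set L},
  forall i, (i < #|L| - #|P|)%N -> T i \subset T i.+1
    /\ exists2 C, max_chain C & (C \subset T i.+1) && ~~ (C \subset T i).
Proof.
pose T i := [set I | (position I < if i == 0 then 0 else #|P| + i)%N].
exists T => i lt_i; split.
  apply/subsetP => I; rewrite !inE; case: i {lt_i} => //= i /ltn_trans.
  by apply; rewrite ltn_add2l.
case: i => [|i] in lt_i *.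
  exists (sweep \bot%O); first exact: sweep_max_chain.
  apply/andP; split; last first.
    by apply/subsetPn; exists \bot%O; rewrite ?sweep_self ?inE.
  have bot0 : inversions \bot%O = set0.
    apply/eqP; rewrite -subset0; apply/subsetP => -[a b].
    rewrite inE => /and3P[_ _ /= b0].
    by have /negP[] : b \notin (set0 : {set P}) by rewrite in_set0.
  apply/subsetP => U /sweep_inversions; rewrite inE addn1 ltnS => U_inv.
  apply: position_no_inversion; case: U_inv => [//|[-> //|]].
  by rewrite bot0 cards0 ltn0.
have lt_size : (#|P| + i.+1 < size inversion_order)%N.
  by rewrite size_sort -cardE -ltn_subRL.
pose I := nth \bot%O inversion_order (#|P| + i.+1).
have posI : position I = (#|P| + i.+1)%N.
  by rewrite /position index_uniq // uniq_inversion_order.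
exists (sweep I); first exact: sweep_max_chain.
apply/andP; split; last first.
  by apply/subsetPn; exists I; rewrite ?sweep_self // inE posI ltnn.
apply/subsetP => U /sweep_inversions; rewrite inE [(_ + i.+2)%N]addnS ltnS /=.
case=> [/position_no_inversion/leq_trans->//|[->|]]; first exact: leq_addr.
  by rewrite posI.
by move/lt_position; rewrite posI => /ltnW.
Qed.

End Ideals.

(** * Killing the variables outside a set of vertices *)

Section FaceMap.
Context (K : fieldType) (disp : Order.disp_t) (L : finDistrLatticeType disp).
Implicit Types (T C : {set L}).

Lemma chain_monE C :
  chain_mon K C = 'X_[ [multinom (enum_val i \in C : nat) | i < #|L|] ].
Proof.
rewrite mpolyXE_id (reindex (@enum_rank L)) /=; last first.
  by apply: onW_bij; exact: enum_rank_bij.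
rewrite /chain_mon [LHS]big_mkcond; apply: eq_bigr => x _.
by rewrite mnmE enum_rankK; case: (x \in C).
Qed.

Definition face_var T (i : 'I_#|L|) : {mpoly K[#|L|]} :=
  if enum_val i \in T then 'X_i else 0.

Definition face T : {rmorphism {mpoly K[#|L|]} -> {mpoly K[#|L|]}} :=
  mmap (@mpolyC #|L| K) (face_var T).

Lemma face_chain_mon T C :
  face T (chain_mon K C) = if C \subset T then chain_mon K C else 0.
Proof.
rewrite /chain_mon rmorph_prod /=.
case: ifPn => [/subsetP CT|/subsetPn[x xC xT]].
  by apply: eq_bigr => x /CT xT; rewrite mmapX mmap1U /face_var enum_rankK xT.
by rewrite (bigD1 x xC) /= mmapX mmap1U /face_var enum_rankK (negPf xT) mul0r.
Qed.

Lemma face_sub T T' f : T \subset T' -> face T (face T' f) = face T f.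
Proof.
move=> sTT'; rewrite /= {2}/mmap raddf_sum /=.
rewrite [RHS]/mmap; apply: eq_bigr => m _.
rewrite rmorphM /= mmapC; congr (_ * _).
rewrite /mmap1 rmorph_prod /=; apply: eq_bigr => i _.
rewrite rmorphXn /= {2}/face_var; case: ifPn => [iT|iT].
  by rewrite mmapX mmap1U.
rewrite rmorph0 /face_var; case: ifPn => // iT'.
by rewrite (subsetP sTT' _ iT') in iT.
Qed.

End FaceMap.

(** * The chain algebra of a lattice of ideals *)

Section Chains.
Context (K : fieldType) (disp : Order.disp_t) (P : finPOrderType disp).
Local Notation L := (ideals P).

Lemma chain_mon_in (C : {set L}) : max_chain C ->
  chain_mon K C \in gen_alg_pred [seq chain_mon K C | C in @max_chain _ L].
Proof.
by move=> C_max; apply/asboolP => S _; apply; apply/imageP; exists C.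
Qed.

(** The kernel of the face map of T decreases with T, so the filtration is run
    through backwards. *)
Lemma exists_prime_chain :
  exists p : 'I_(#|L| - #|P|).+1 -> prime_idealr (chain_algebra K L),
    prime_chain p.
Proof.
have [T T_step] := max_chain_filtration P; set d := (#|L| - #|P|)%N.
have T_sub i k : (i + k <= d)%N -> T i \subset T (i + k)%N.
  elim: k => [|k IHk]; first by rewrite addn0.
  rewrite addnS => lt_d; apply: subset_trans (IHk (ltnW lt_d)) _.
  by case: (T_step _ lt_d).
have [I IE] : exists I : nat -> prime_idealr (chain_algebra K L),
    forall i x, (x \in I i) = (face K (T i) (val x) == 0).
  by exists (fun i => kernel (face K (T i) \o
    (val : {rmorphism chain_algebra K L -> _})) : prime_idealr _).
exists (fun i => I (d - i)%N) => i j lt_ij.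
have le_jd : (j <= d)%N by rewrite -ltnS.
have leij : (d - j <= d - i)%N by rewrite leq_sub2l // ltnW.
split=> [x|].
  rewrite !IE => /eqP x0; rewrite -(@face_sub _ _ _ _ (T (d - i)%N)).
    by rewrite x0 rmorph0.
  have := T_sub (d - j)%N (d - i - (d - j))%N.
  by rewrite subnKC ?leq_subr //; apply.
have gt0j : (0 < j)%N := leq_ltn_trans (leq0n i) lt_ij.
have ltd : (d - j < d)%N by rewrite ltn_subrL gt0j (leq_trans gt0j).
have [_ [C C_max /andP[CT CnT]]] := T_step _ ltd.
exists (GenAlg (chain_mon_in C_max)).
  by rewrite IE /= face_chain_mon (negPf CnT).
rewrite IE /= face_chain_mon.
have -> : C \subset T (d - i)%N.
  apply: subset_trans CT _.
  have le1 : ((d - j).+1 <= d - i)%N by rewrite ltn_sub2l // (leq_trans lt_ij).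
  have := T_sub (d - j).+1 (d - i - (d - j).+1)%N.
  by rewrite subnKC ?leq_subr //; apply.
by rewrite chain_monE -msupp_eq0 msuppX.
Qed.

(** Level zero consists of the empty ideal alone, whence the right-hand side. *)
Definition balanced : pred 'X_{1..#|L|} := fun m =>
  [forall k : 'I_#|P|.+1,
     (\sum_(I : L | #|I| == k) m (enum_rank I))%N
       == m (enum_rank (\bot%O : L))].

Lemma chain_algebra_balanced (r : chain_algebra K L) m :
  m \in msupp (val r) -> balanced m.
Proof.
apply: gen_alg_msupp => {r m}
  [|m m' /forallP mb /forallP mb'|g m /imageP[C C_max ->]].
- by apply/forallP => k; rewrite mnm0E big1 // => I _; rewrite mnm0E.
- apply/forallP => k; rewrite mnmDE -(eqP (mb k)) -(eqP (mb' k)) -big_split /=.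
  by apply/eqP; apply: eq_bigr => I _; rewrite mnmDE.
rewrite chain_monE msuppX inE => /eqP->; apply/forallP => k.
have [I IC cardI] := max_chain_level C_max (ltn_ord k : (k <= #|P|)%N).
rewrite mnmE enum_rankK (bot_max_chain C_max).
rewrite (bigD1 I) ?cardI //= mnmE enum_rankK IC big1 //.
move=> J /andP[/eqP cardJ neqJI].
rewrite mnmE enum_rankK; case: (boolP (J \in C)) => // JC; case/eqP: neqJI.
apply: card_comparable_inj; last by rewrite cardI.
by have /chainP := maxsetp C_max; apply.
Qed.

Definition free_vertices (C : {set L}) : {set L} := \bot%O |: ~: C.

Lemma card_free_vertices C : max_chain C ->
  #|free_vertices C| = (#|L| - #|P|)%N.
Proof.
move=> C_max; rewrite cardsU1 inE (bot_max_chain C_max) /= add1n.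
have := cardsC C; rewrite (card_max_chain C_max) => <-.
by rewrite addSnnS addKn.
Qed.

(** The exponent at a vertex of C other than the empty ideal is the common level
    sum minus the exponents at the other vertices of its level, none of which
    lies on C. *)
Lemma balanced_det C m m' : max_chain C -> balanced m -> balanced m' ->
  {in enum_rank @: free_vertices C, m =1 m'} -> m = m'.
Proof.
move=> C_max /forallP mb /forallP mb' mm'.
have eq_free I : I \in free_vertices C -> m (enum_rank I) = m' (enum_rank I).
  by move=> IW; apply/mm'/imset_f.
apply/mnmP => i; rewrite -(enum_valK i); set I := enum_val i.
have [IW|IW] := boolP (I \in free_vertices C); first exact: eq_free.
have IC : I \in C by move: IW; rewrite !inE negb_or negbK => /andP[].
have ltI : (#|I| < #|P|.+1)%N by rewrite ltnS max_card.
have /eqP := mb (Ordinal ltI); have /eqP := mb' (Ordinal ltI).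
rewrite (eq_free \bot%O) ?setU11 // => <-.
rewrite (bigD1 I) //= [in RHS](bigD1 I) //=.
rewrite (eq_bigr (fun J : L => m' (enum_rank J))) => [|J]; first exact: addIn.
case/andP=> /eqP cardJ neqJI.
apply: eq_free; rewrite !inE orbC; apply/orP; left.
apply: contra neqJI => JC; apply/eqP/card_comparable_inj => //.
by have /chainP := maxsetp C_max; apply.
Qed.

End Chains.

Theorem theorem2p4 (K : fieldType) (disp : Order.disp_t)
    (P : finPOrderType disp) :
  krull_dim (chain_algebra K (ideals P)) (#|ideals P| - #|P|)%N.
Proof.
split=> [|n p pp]; first exact: exists_prime_chain.
have C_max := sweep_max_chain (\bot%O : ideals P).
rewrite -(card_free_vertices C_max) -(card_imset _ (@enum_rank_inj _)).
apply: (@prime_chain_length_le K _ (chain_algebra K (ideals P))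
  (val : {rmorphism chain_algebra K (ideals P) -> _}) (@balanced _ P)
  _ _ _ _ _ n p pp).
- by [].
- exact: val_inj.
- exact: chain_algebra_balanced.
- by move=> m m'; apply: balanced_det.
Qed.
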